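(* Let $\mathcal{C}$ be a left (respectively right) closed monoidal category and let $\mathbb{D}$ be a pivotal diagram in $\mathcal{C}$. Then the monoidal category $\mathcal{C}(\mathbb{D})$ of $\mathbb{D}$-intertwined objects has a left (respectively right) closed monoidal structure which lifts that of $\mathcal{C}$, and the forgetful functor $U_{\mathbb{D}}:\mathcal{C}(\mathbb{D})\to\mathcal{C}$, $(X,\{\sigma_i\}_{i\in I})\mapsto X$, is left (respectively right) closed.
   Context: Monoidal categories $(\mathcal{C},\otimes,\mathbf 1)$ are assumed strict; object names also denote identity morphisms. A pivotal pair $(P,Q)$ in $\mathcal{C}$ consists of objects $P,Q$ with morphisms $\mathrm{coev}:\mathbf 1\to P\otimes Q$, $\mathrm{ev}:Q\otimes P\to\mathbf 1$ making $Q$ a left dual of $P$, i.e. $(\mathrm{ev}\otimes Q)(Q\otimes\mathrm{coev})=\mathrm{id}_Q$, $(P\otimes\mathrm{ev})(\mathrm{coev}\otimes P)=\mathrm{id}_P$, and morphisms $\underline{\mathrm{coev}}:\mathbf 1\to Q\otimes P$, $\underline{\mathrm{ev}}:P\otimes Q\to\mathbf 1$ making $Q$ a right dual of $P$, i.e. $(\underline{\mathrm{ev}}\otimes P)(P\otimes\underline{\mathrm{coev}})=\mathrm{id}_P$, $(Q\otimes\underline{\mathrm{ev}})(\underline{\mathrm{coev}}\otimes Q)=\mathrm{id}_Q$. The category $\mathcal{C}(P,Q)$: objects are pairs $(X,\sigma)$ with $X$ an object of $\mathcal{C}$ and $\sigma:X\otimes P\to P\otimes X$ an invertible morphism such that the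 two morphisms $$(\mathrm{ev}\otimes X\otimes Q)(Q\otimes\sigma\otimes Q)(Q\otimes X\otimes\mathrm{coev}):Q\otimes X\to X\otimes Q,$$ $$(Q\otimes X\otimes\underline{\mathrm{ev}})(Q\otimes\sigma^{-1}\otimes Q)(\underline{\mathrm{coev}}\otimes X\otimes Q):X\otimes Q\to Q\otimes X$$ are inverse to each other. Let $\mathcal{C}_0^{piv}$ be the category whose objects are pivotal pairs in $\mathcal{C}$ and whose morphisms $(P_1,Q_1)\to(P_2,Q_2)$ are all morphisms $f:P_1\to P_2$ in $\mathcal{C}$. A pivotal diagram is a functor $\mathbb{D}:\mathcal{J}\to\mathcal{C}_0^{piv}$ from a small category $\mathcal{J}$; it amounts to a family of pivotal pairs $(P_i,Q_i)$, $i\in I$ (the objects of $\mathcal J$), and morphisms $f_j:P_{j_s}\to P_{j_t}$, $j\in J$ (the morphisms of $\mathcal J$, with source $j_s\in I$ and target $j_t\in I$). The category $\mathcal{C}(\mathbb{D})$: objects are pairs $(X,\{\sigma_i\}_{i\in I})$ with $X$ an object of $\mathcal{C}$ and $\sigma_i:X\otimes P_i\to P_i\otimes X$ such that $(X,\sigma_i)$ is an object of $\mathcal{C}(P_i,Q_i)$ for all $i\in I$ and $(f_j\otimes X)\sigma_{j_s}=\sigma_{j_t}(X\otimes f_j)$ for all $j\in J$. Morphisms $(X,\{\sigma_i\})\to(Y,\{\tau_i\})$ are morphisms $f:X\to Y$ in $\mathcal{C}$ with $\tau_i(f\otimes P_i)=(P_i\otimes f)\sigma_i$ for all $i$. Its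 tensor product is $(X,\{\sigma_i\})\otimes(Y,\{\tau_i\})=(X\otimes Y,\{(\sigma_i\otimes Y)(X\otimes\tau_i)\})$, with unit $(\mathbf 1,\{\mathrm{id}_{P_i}\})$; $U_{\mathbb{D}}$ is strict monoidal. A monoidal category is left (right) closed if for every object $A$ the functor $-\otimes A$ (respectively $A\otimes-$) has a right adjoint $[A,-]^{l}$ (respectively $[A,-]^{r}$). The closed structure lifts along $U_{\mathbb{D}}$ if the corresponding right adjoints exist in $\mathcal{C}(\mathbb{D})$, have underlying functors $[A,U_{\mathbb{D}}(-)]^{l}$ (respectively $[A,U_{\mathbb{D}}(-)]^{r}$), and $U_{\mathbb{D}}$ sends their units and counits to those in $\mathcal{C}$. A monoidal functor $F$ is left (right) closed if the canonical morphisms $F([X,Y])\to[F(X),F(Y)]$ between left (right) inner homs are isomorphisms. *)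

(* Defs.v *)
From mathcomp Require Import ssreflect ssrfun ssrbool.
From Stdlib Require Import ProofIrrelevance FunctionalExtensionality ClassicalEpsilon.

Set Implicit Arguments.
Unset Strict Implicit.
Unset Printing Implicit Defensive.

Declare Scope cat_scope.
Delimit Scope cat_scope with cat.
Local Open Scope cat_scope.

Record Category := {
  Ob :> Type;
  Hom : Ob -> Ob -> Type;
  idm : forall A, Hom A A;
  comp : forall A B C, Hom B C -> Hom A B -> Hom A C;
  comp_idl : forall A B (f : Hom A B), comp (idm B) f = f;
  comp_idr : forall A B (f : Hom A B), comp f (idm A) = f;
  compA : forall A B C D (h : Hom C D) (g : Hom B C) (f : Hom A B),
    comp h (comp g f) = comp (comp h g) f
}.
Arguments Hom {c} _ _.
Arguments idm {c} _.
Arguments comp {c A B C} _ _.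
Notation "g ∘ f" := (comp g f) (at level 40, left associativity) : cat_scope.

Definition inverse {C : Category} {A B : C} (f : Hom A B) (g : Hom B A) : Prop :=
  g ∘ f = idm A /\ f ∘ g = idm B.

Definition is_iso {C : Category} {A B : C} (f : Hom A B) : Prop :=
  exists g, inverse f g.

Record Functor (C D : Category) := {
  fob :> C -> D;
  fmap : forall A B, Hom A B -> Hom (fob A) (fob B);
  fmap_id : forall A, fmap (idm A) = idm (fob A);
  fmap_comp : forall A B E (g : Hom B E) (f : Hom A B),
    fmap (g ∘ f) = fmap g ∘ fmap f
}.
Arguments fmap {C D} _ {A B} _.

Program Definition functor_comp {C D E : Category}
    (G : Functor D E) (F : Functor C D) : Functor C E :=
  {| fob X := G (F X); fmap A B f := fmap G (fmap F f) |}.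
Next Obligation. by rewrite !fmap_id. Qed.
Next Obligation. by rewrite !fmap_comp. Qed.
Notation "G ∘F F" := (functor_comp G F)
  (at level 40, left associativity) : cat_scope.

Record RightAdjoint {C D : Category} (F : Functor C D) := {
  radj :> Functor D C;
  adj_unit : forall X : C, Hom X (radj (F X));
  adj_counit : forall Y : D, Hom (F (radj Y)) Y;
  adj_unit_nat : forall (X X' : C) (f : Hom X X'),
    adj_unit X' ∘ f = fmap radj (fmap F f) ∘ adj_unit X;
  adj_counit_nat : forall (Y Y' : D) (g : Hom Y Y'),
    adj_counit Y' ∘ fmap F (fmap radj g) = g ∘ adj_counit Y;
  adj_triangleF : forall X : C,
    adj_counit (F X) ∘ fmap F (adj_unit X) = idm (F X);
  adj_triangleG : forall Y : D,
    fmap radj (adj_counit Y) ∘ adj_unit (radj Y) = idm (radj Y)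
}.
Arguments adj_unit {C D F} _ _.
Arguments adj_counit {C D F} _ _.

(* In a strict monoidal category the objects [(X ⊗ Y) ⊗ Z] and
   [X ⊗ (Y ⊗ Z)] are equal but not convertible.  Morphisms whose (co)domains
   are only propositionally equal are compared with [≈], equality in the type
   of all morphisms of the category. *)
Record Arrow (C : Category) :=
  MkArrow { dom : C; cod : C; arr : Hom dom cod }.
Arguments MkArrow {C dom cod} _.
Notation "f ≈ g" := (MkArrow f = MkArrow g)
  (at level 70, no associativity) : cat_scope.

Definition hom_cast {C : Category} {A A' B B' : C}
    (f : Hom A B) (eA : A = A') (eB : B = B') : Hom A' B' :=
  match eA in _ = a, eB in _ = b return Hom a b with
  | eq_refl, eq_refl => f
  end.
Arguments hom_cast {C A A' B B'} & f eA eB.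

Definition comp_along {C : Category} {A B B' D : C}
    (g : Hom B' D) (f : Hom A B) (e : B = B') : Hom A D :=
  g ∘ hom_cast f eq_refl e.

Record StrictMonoidal := {
  sm_cat :> Category;
  one : sm_cat;
  ten : sm_cat -> sm_cat -> sm_cat;
  tenm : forall A B A' B',
    @Hom sm_cat A B -> @Hom sm_cat A' B' -> @Hom sm_cat (ten A A') (ten B B');
  tenm_id : forall A B, tenm (idm A) (idm B) = idm (ten A B);
  tenm_comp : forall A B D A' B' D'
    (g : Hom B D) (f : Hom A B) (g' : Hom B' D') (f' : Hom A' B'),
    tenm (g ∘ f) (g' ∘ f') = tenm g g' ∘ tenm f f';
  tenA : forall X Y Z, ten X (ten Y Z) = ten (ten X Y) Z;
  ten1o : forall X, ten one X = X;
  teno1 : forall X, ten X one = X;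
  tenmA : forall A A' B B' D D' (f : Hom A A') (g : Hom B B') (h : Hom D D'),
    tenm f (tenm g h) ≈ tenm (tenm f g) h;
  tenm1l : forall A B (f : Hom A B), tenm (idm one) f ≈ f;
  tenm1r : forall A B (f : Hom A B), tenm f (idm one) ≈ f
}.
Arguments one {s}.
Arguments ten {s} _ _.
Arguments tenm {s A B A' B'} _ _.
Notation "𝟙" := one : cat_scope.
Notation "X ⊗ Y" := (ten X Y) (at level 34, left associativity) : cat_scope.
Notation "f ⊠ g" := (tenm f g) (at level 34, left associativity) : cat_scope.

Ltac strict_eq := by rewrite ?tenA ?ten1o ?teno1 ?tenA.

(* Composition, and change of type, along equalities of objects derived from
   [tenA], [ten1o] and [teno1]; which proof is used is irrelevant. *)
Notation "g ∘! f" := (comp_along g f (ltac:(strict_eq)))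
  (at level 40, left associativity, only parsing) : cat_scope.
Notation "'cast!' f" := (hom_cast f (ltac:(strict_eq)) (ltac:(strict_eq)))
  (at level 35, only parsing) : cat_scope.

Program Definition tensor_right {C : StrictMonoidal} (A : C) : Functor C C :=
  {| fob X := X ⊗ A; fmap X Y f := f ⊠ idm A |}.
Next Obligation. exact: tenm_id. Qed.
Next Obligation. by rewrite -tenm_comp comp_idl. Qed.

Program Definition tensor_left {C : StrictMonoidal} (A : C) : Functor C C :=
  {| fob X := A ⊗ X; fmap X Y f := idm A ⊠ f |}.
Next Obligation. exact: tenm_id. Qed.
Next Obligation. by rewrite -tenm_comp comp_idl. Qed.

Definition LeftClosed (C : StrictMonoidal) : Type :=
  forall A : C, RightAdjoint (tensor_right A).

Definition RightClosed (C : StrictMonoidal) : Type :=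
  forall A : C, RightAdjoint (tensor_left A).

Record StrictMonoidalFunctor (C D : StrictMonoidal) := {
  smf_functor :> Functor C D;
  smf_one : smf_functor 𝟙 = 𝟙;
  smf_ten : forall X Y, smf_functor X ⊗ smf_functor Y = smf_functor (X ⊗ Y);
  smf_tenm : forall A B A' B' (f : Hom A B) (g : Hom A' B'),
    fmap smf_functor f ⊠ fmap smf_functor g ≈ fmap smf_functor (f ⊠ g)
}.

Section ClosedFunctors.
Variables (C D : StrictMonoidal) (F : StrictMonoidalFunctor C D).

(* [F [A,Y] -> [F A, F Y]], the transpose of
   [F [A,Y] ⊗ F A = F ([A,Y] ⊗ A) -> F Y]. *)
Definition left_comparison (K : LeftClosed C) (L : LeftClosed D) (A Y : C) :
    Hom (F (K A Y)) (L (F A) (F Y)) :=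
  fmap (L (F A))
    (comp_along (fmap F (adj_counit (K A) Y)) (idm (F (K A Y) ⊗ F A))
                (smf_ten F (K A Y) A))
  ∘ adj_unit (L (F A)) (F (K A Y)).

Definition right_comparison (K : RightClosed C) (L : RightClosed D) (A Y : C) :
    Hom (F (K A Y)) (L (F A) (F Y)) :=
  fmap (L (F A))
    (comp_along (fmap F (adj_counit (K A) Y)) (idm (F A ⊗ F (K A Y)))
                (smf_ten F A (K A Y)))
  ∘ adj_unit (L (F A)) (F (K A Y)).

Definition left_closed_functor (K : LeftClosed C) (L : LeftClosed D) : Prop :=
  forall A Y : C, is_iso (left_comparison K L A Y).

Definition right_closed_functor (K : RightClosed C) (L : RightClosed D) : Prop :=
  forall A Y : C, is_iso (right_comparison K L A Y).

Definition lifts_left_closed (K : LeftClosed C) (L : LeftClosed D) : Prop :=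
  forall A : C,
    [/\ F ∘F K A = L (F A) ∘F F,
        forall X : C, fmap F (adj_unit (K A) X) ≈ adj_unit (L (F A)) (F X)
      & forall X : C, fmap F (adj_counit (K A) X) ≈ adj_counit (L (F A)) (F X)].

Definition lifts_right_closed (K : RightClosed C) (L : RightClosed D) : Prop :=
  forall A : C,
    [/\ F ∘F K A = L (F A) ∘F F,
        forall X : C, fmap F (adj_unit (K A) X) ≈ adj_unit (L (F A)) (F X)
      & forall X : C, fmap F (adj_counit (K A) X) ≈ adj_counit (L (F A)) (F X)].

End ClosedFunctors.

(* [Q] is a left dual of [P] through [coev], [ev], and a right dual through
   [rcoev], [rev] (written with an underline on paper). *)
Record PivotalPair (C : StrictMonoidal) := {
  pivP : C;
  pivQ : C;
  coev : Hom 𝟙 (pivP ⊗ pivQ);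
  ev : Hom (pivQ ⊗ pivP) 𝟙;
  rcoev : Hom 𝟙 (pivQ ⊗ pivP);
  rev : Hom (pivP ⊗ pivQ) 𝟙;
  ev_coev_Q : (ev ⊠ idm pivQ) ∘! (idm pivQ ⊠ coev) ≈ idm pivQ;
  ev_coev_P : (idm pivP ⊠ ev) ∘! (coev ⊠ idm pivP) ≈ idm pivP;
  rev_rcoev_P : (rev ⊠ idm pivP) ∘! (idm pivP ⊠ rcoev) ≈ idm pivP;
  rev_rcoev_Q : (idm pivQ ⊠ rev) ∘! (rcoev ⊠ idm pivQ) ≈ idm pivQ
}.

Definition PivotalCategory (C : StrictMonoidal) : Category := {|
  Ob := PivotalPair C;
  Hom p q := Hom (pivP p) (pivP q);
  idm p := idm (pivP p);
  comp p q r g f := g ∘ f;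
  comp_idl p q f := comp_idl f;
  comp_idr p q f := comp_idr f;
  compA p q r s h g f := compA h g f
|}.

Definition PivotalDiagram (J : Category) (C : StrictMonoidal) : Type :=
  Functor J (PivotalCategory C).

Section Intertwining.
Variables (C : StrictMonoidal) (p : PivotalPair C).
Local Notation P := (pivP p).
Local Notation Q := (pivQ p).

Definition bendQ (X : C) (s : Hom (X ⊗ P) (P ⊗ X)) : Hom (Q ⊗ X) (X ⊗ Q) :=
  cast! ((ev p ⊠ idm X ⊠ idm Q)
         ∘! (idm Q ⊠ s ⊠ idm Q)
         ∘! (idm Q ⊠ idm X ⊠ coev p)).

Definition bendQ_inv (X : C) (t : Hom (P ⊗ X) (X ⊗ P)) : Hom (X ⊗ Q) (Q ⊗ X) :=
  cast! ((idm Q ⊠ idm X ⊠ rev p)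
         ∘! (idm Q ⊠ t ⊠ idm Q)
         ∘! (rcoev p ⊠ idm X ⊠ idm Q)).

(* [(X, s)] is an object of [C(P,Q)]; the witness [t] is the inverse of [s]. *)
Definition intertwining (X : C) (s : Hom (X ⊗ P) (P ⊗ X)) : Prop :=
  exists t, inverse s t /\ inverse (bendQ s) (bendQ_inv t).

Definition unit_braid : Hom (𝟙 ⊗ P) (P ⊗ 𝟙) := cast! (idm P).

Definition tensor_braid (X Y : C)
    (s : Hom (X ⊗ P) (P ⊗ X)) (t : Hom (Y ⊗ P) (P ⊗ Y)) :
    Hom (X ⊗ Y ⊗ P) (P ⊗ (X ⊗ Y)) :=
  cast! ((s ⊠ idm Y) ∘! (idm X ⊠ t)).

End Intertwining.

Lemma Arrow_inj (C : Category) (A B : C) (f g : Hom A B) : f ≈ g -> f = g.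
Proof.
move=> e; pose k (a : Arrow C) (d : A = dom a) (c : B = cod a) :=
  hom_cast (arr a) (esym d) (esym c).
have H a (ea : MkArrow f = a) d c : k a d c = f.
  case: _ / ea d c => d c.
  by rewrite /k (proof_irrelevance _ d erefl) (proof_irrelevance _ c erefl).
by rewrite -(H _ e erefl erefl).
Qed.

Lemma hom_castE (C : Category) (A A' B B' : C) (f : Hom A B)
    (eA : A = A') (eB : B = B') : hom_cast f eA eB ≈ f.
Proof. by case: _ / eA; case: _ / eB. Qed.

(* Total composition of bundled morphisms, meaningful only on composable
   arguments; [aten] below is associative and unital on the nose. *)
Definition acomp (C : Category) (g f : Arrow C) : Arrow C :=
  match excluded_middle_informative (cod f = dom g) with
  | left e => MkArrow (comp_along (arr g) (arr f) e)
  | right _ => f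
  end.

Lemma comp_alongE (C : Category) (A B B' D : C)
    (g : Hom B' D) (f : Hom A B) (e : B = B') :
  MkArrow (comp_along g f e) = acomp (MkArrow g) (MkArrow f).
Proof.
rewrite /acomp; case: excluded_middle_informative => [e'|//] /=.
by rewrite (proof_irrelevance _ e e').
Qed.

Lemma compE (C : Category) (A B D : C) (g : Hom B D) (f : Hom A B) :
  MkArrow (g ∘ f) = acomp (MkArrow g) (MkArrow f).
Proof. by rewrite -(comp_alongE g f erefl). Qed.

Lemma dom_acomp (C : Category) (g f : Arrow C) : dom (acomp g f) = dom f.
Proof. by rewrite /acomp; case: excluded_middle_informative. Qed.

Lemma cod_acomp (C : Category) (g f : Arrow C) :
  cod f = dom g -> cod (acomp g f) = cod g.
Proof. by rewrite /acomp; case: excluded_middle_informative. Qed.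

Lemma acompA (C : Category) (h g f : Arrow C) :
    cod f = dom g -> cod g = dom h ->
  acomp h (acomp g f) = acomp (acomp h g) f.
Proof.
case: h g f => [? ? h] [? ? g] [? ? f] /= e e'.
by case: _ / e g => g; case: _ / e' h => h; rewrite -!compE compA.
Qed.

Definition aid (C : Category) (A : C) : Arrow C := MkArrow (idm A).

Lemma acomp_idl (C : Category) (f : Arrow C) (A : C) :
  cod f = A -> acomp (aid A) f = f.
Proof. by move=> <-; case: f => ? ? f; rewrite -compE comp_idl. Qed.

Lemma acomp_idr (C : Category) (f : Arrow C) (A : C) :
  dom f = A -> acomp f (aid A) = f.
Proof. by move=> <-; case: f => ? ? f; rewrite -compE comp_idr. Qed.

Definition aten (C : StrictMonoidal) (f g : Arrow C) : Arrow C :=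
  MkArrow (arr f ⊠ arr g).

Lemma atenA (C : StrictMonoidal) (f g h : Arrow C) :
  aten f (aten g h) = aten (aten f g) h.
Proof. exact: tenmA. Qed.

Lemma atenE (C : StrictMonoidal) (A B A' B' : C)
  (f : Hom A B) (g : Hom A' B') : MkArrow (f ⊠ g) = aten (MkArrow f) (MkArrow g).
Proof. by []. Qed.

Lemma aten_comp (C : StrictMonoidal) (g f g' f' : Arrow C) :
    cod f = dom g -> cod f' = dom g' ->
  aten (acomp g f) (acomp g' f') = acomp (aten g g') (aten f f').
Proof.
case: g f g' f' => [? ? g] [? ? f] [? ? g'] [? ? f'] /= e e'.
case: _ / e g => g; case: _ / e' g' => g'.
by rewrite -!compE /aten /= tenm_comp compE.
Qed.

Lemma aten_id (C : StrictMonoidal) (A B : C) : aten (aid A) (aid B) = aid (A ⊗ B).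
Proof. by rewrite /aten /= tenm_id. Qed.

Lemma aten1l (C : StrictMonoidal) (f : Arrow C) : aten (aid 𝟙) f = f.
Proof. by case: f => ? ? f; apply: tenm1l. Qed.

Lemma aten1r (C : StrictMonoidal) (f : Arrow C) : aten f (aid 𝟙) = f.
Proof. by case: f => ? ? f; apply: tenm1r. Qed.

Lemma comp_along_erefl (C : Category) (A B D : C) (g : Hom B D) (f : Hom A B) e :
  comp_along g f e = g ∘ f.
Proof. by rewrite (proof_irrelevance _ e erefl). Qed.

Arguments acomp : simpl never.

Ltac objs :=
  rewrite /= ?(dom_acomp, cod_acomp) /= ?(tenA, ten1o, teno1) //=.

Lemma acomp_ten1 (C : StrictMonoidal) (g f : Arrow C) (A : C) : cod f = dom g ->
  aten (aid A) (acomp g f) = acomp (aten (aid A) g) (aten (aid A) f).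
Proof. by move=> e; rewrite -aten_comp // acomp_idl. Qed.

Lemma acomp_ten2 (C : StrictMonoidal) (g f : Arrow C) (A : C) : cod f = dom g ->
  aten (acomp g f) (aid A) = acomp (aten g (aid A)) (aten f (aid A)).
Proof. by move=> e; rewrite -aten_comp // acomp_idl. Qed.

Lemma slide (C : StrictMonoidal) (f g : Arrow C) (A A' B B' : C) :
    dom f = A -> cod f = A' -> dom g = B -> cod g = B' ->
  acomp (aten (aid A') g) (aten f (aid B)) = acomp (aten f (aid B')) (aten (aid A) g).
Proof.
move=> <- <- <- <-.
by rewrite -!aten_comp // !acomp_idl // !acomp_idr.
Qed.

Section TensorIntertwining.
Variables (C : StrictMonoidal) (p : PivotalPair C).
Local Notation P := (pivP p).
Local Notation Q := (pivQ p).
Local Notation "'ι' X" := (aid X) (at level 10).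
Local Notation "'μ' f" := (MkArrow f) (at level 10).
Local Infix "**" := aten (at level 34, left associativity).
Local Infix "@@" := acomp (at level 40, left associativity).

Lemma bendQE X (s : Hom (X ⊗ P) (P ⊗ X)) :
  μ (bendQ s) = (μ (ev p) ** ι X ** ι Q) @@ (ι Q ** μ s ** ι Q)
                @@ (ι Q ** ι X ** μ (coev p)).
Proof. by rewrite hom_castE !comp_alongE. Qed.

Lemma bendQ_invE X (t : Hom (P ⊗ X) (X ⊗ P)) :
  μ (bendQ_inv t) = (ι Q ** ι X ** μ (rev p)) @@ (ι Q ** μ t ** ι Q)
                    @@ (μ (rcoev p) ** ι X ** ι Q).
Proof. by rewrite hom_castE !comp_alongE. Qed.

Lemma bendQ_coev X (s : Hom (X ⊗ P) (P ⊗ X)) :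
  (ι P ** μ (bendQ s)) @@ (μ (coev p) ** ι X) = (μ s ** ι Q) @@ (ι X ** μ (coev p)).
Proof.
have zig : (ι P ** μ (ev p)) @@ (μ (coev p) ** ι P) = ι P.
  by have := ev_coev_P p; rewrite comp_alongE.
rewrite bendQE !acomp_ten1; try by objs.
rewrite -acompA; try by objs.
have -> : ι P ** (ι Q ** ι X ** μ (coev p)) = ι (P ⊗ Q) ** (ι X ** μ (coev p)).
  by rewrite -aten_id !atenA.
rewrite (slide (f := μ (coev p)) (A := 𝟙) (B' := X ⊗ P ⊗ Q)); try by objs.
rewrite aten1l acompA; try by objs.
rewrite -(acompA (h := ι P ** (μ (ev p) ** ι X ** ι Q))); try by objs.
have -> : ι P ** (ι Q ** μ s ** ι Q) = ι (P ⊗ Q) ** (μ s ** ι Q).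
  by rewrite -aten_id !atenA.
rewrite (slide (f := μ (coev p)) (A := 𝟙) (B' := P ⊗ X ⊗ Q)); try by objs.
rewrite aten1l acompA; try by objs.
have -> : ι P ** (μ (ev p) ** ι X ** ι Q) @@ (μ (coev p) ** ι (P ⊗ X ⊗ Q))
          = ι (P ⊗ X ⊗ Q).
  rewrite -!aten_id !atenA -acomp_ten2 -?acomp_ten2; try by objs.
  by rewrite zig.
by rewrite acomp_idl //; objs.
Qed.

Lemma rev_bendQ_inv X (t : Hom (P ⊗ X) (X ⊗ P)) :
  (μ (rev p) ** ι X) @@ (ι P ** μ (bendQ_inv t)) = (ι X ** μ (rev p)) @@ (μ t ** ι Q).
Proof.
have zig : (μ (rev p) ** ι P) @@ (ι P ** μ (rcoev p)) = ι P.
  by have := rev_rcoev_P p; rewrite comp_alongE.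
rewrite bendQ_invE !acomp_ten1; try by objs.
rewrite !acompA; try by objs.
have -> : ι P ** (ι Q ** ι X ** μ (rev p)) = ι (P ⊗ Q) ** (ι X ** μ (rev p)).
  by rewrite -aten_id !atenA.
rewrite -(slide (f := μ (rev p)) (A' := 𝟙) (B := X ⊗ P ⊗ Q)); try by objs.
rewrite aten1l -(acompA (h := ι X ** μ (rev p))); try by objs.
have -> : ι P ** (ι Q ** μ t ** ι Q) = ι (P ⊗ Q) ** (μ t ** ι Q).
  by rewrite -aten_id !atenA.
rewrite -(slide (f := μ (rev p)) (A' := 𝟙) (B := P ⊗ X ⊗ Q)); try by objs.
rewrite aten1l -!acompA; try by objs.
have -> : (μ (rev p) ** ι (P ⊗ X ⊗ Q)) @@ (ι P ** (μ (rcoev p) ** ι X ** ι Q))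
          = ι (P ⊗ X ⊗ Q).
  rewrite -!aten_id !atenA -acomp_ten2 -?acomp_ten2; try by objs.
  by rewrite zig.
by rewrite acomp_idr //; objs.
Qed.

Lemma bendQ_tensor X Y (s : Hom (X ⊗ P) (P ⊗ X)) (t : Hom (Y ⊗ P) (P ⊗ Y)) :
  μ (bendQ (tensor_braid s t))
  = (ι X ** μ (bendQ t)) @@ (μ (bendQ s) ** ι Y).
Proof.
rewrite (bendQE s) !acomp_ten2; try by objs.
rewrite !acompA; try by objs.
have -> : μ (ev p) ** ι X ** ι Q ** ι Y = (μ (ev p) ** ι X) ** ι (Q ⊗ Y).
  by rewrite -aten_id !atenA.
rewrite (slide (A := Q ⊗ P ⊗ X) (B' := Y ⊗ Q)); try by objs.
rewrite -(acompA (h := μ (ev p) ** ι X ** ι (Y ⊗ Q))); try by objs.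
have -> : ι (Q ⊗ P ⊗ X) ** μ (bendQ t) = ι (Q ⊗ (P ⊗ X)) ** μ (bendQ t).
  by rewrite tenA.
have -> : ι Q ** μ s ** ι Q ** ι Y = (ι Q ** μ s) ** ι (Q ⊗ Y).
  by rewrite -aten_id !atenA.
rewrite (slide (A := Q ⊗ (X ⊗ P)) (B' := Y ⊗ Q)); try by objs.
rewrite acompA; try by objs.
rewrite -(acompA (f := ι Q ** ι X ** μ (coev p) ** ι Y)); try by objs.
have -> : (ι (Q ⊗ (X ⊗ P)) ** μ (bendQ t)) @@ (ι Q ** ι X ** μ (coev p) ** ι Y)
   = ι (Q ⊗ X) ** ((μ t ** ι Q) @@ (ι Y ** μ (coev p))).
  rewrite -bendQ_coev acomp_ten1; try by objs.
  by rewrite -!aten_id !atenA.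
rewrite bendQE hom_castE comp_alongE !acomp_ten1 ?acomp_ten2; try by objs.
rewrite !acompA; try by objs.
by rewrite -!aten_id !(atenE s, atenE (idm X)) !atenA.
Qed.

Lemma bendQ_inv_tensor X Y (s : Hom (P ⊗ X) (X ⊗ P)) (t : Hom (P ⊗ Y) (Y ⊗ P))
    (st : Hom (P ⊗ (X ⊗ Y)) (X ⊗ Y ⊗ P)) :
    μ st = (ι X ** μ t) @@ (μ s ** ι Y) ->
  μ (bendQ_inv st) = (μ (bendQ_inv s) ** ι Y) @@ (ι X ** μ (bendQ_inv t)).
Proof.
move=> est.
rewrite (bendQ_invE s) !acomp_ten2; try by objs.
rewrite -!acompA; try by objs.
have -> : μ (rcoev p) ** ι X ** ι Q ** ι Y = (μ (rcoev p) ** ι X) ** ι (Q ⊗ Y).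
  by rewrite -aten_id !atenA.
rewrite -(slide (A' := Q ⊗ P ⊗ X) (B := Y ⊗ Q)); try by objs.
rewrite (acompA (f := μ (rcoev p) ** ι X ** ι (Y ⊗ Q))); try by objs.
have -> : ι (Q ⊗ P ⊗ X) ** μ (bendQ_inv t) = ι (Q ⊗ (P ⊗ X)) ** μ (bendQ_inv t).
  by rewrite tenA.
have -> : ι Q ** μ s ** ι Q ** ι Y = (ι Q ** μ s) ** ι (Q ⊗ Y).
  by rewrite -aten_id !atenA.
rewrite -(slide (A' := Q ⊗ (X ⊗ P)) (B := Y ⊗ Q)); try by objs.
rewrite !acompA; try by objs.
have -> : (ι Q ** ι X ** μ (rev p) ** ι Y) @@ (ι (Q ⊗ (X ⊗ P)) ** μ (bendQ_inv t))
   = ι (Q ⊗ X) ** ((ι Y ** μ (rev p)) @@ (μ t ** ι Q)).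
  rewrite -rev_bendQ_inv acomp_ten1; try by objs.
  by rewrite -!aten_id !atenA.
rewrite bendQ_invE est !acomp_ten1 ?acomp_ten2; try by objs.
rewrite !acompA; try by objs.
by rewrite -!aten_id !atenA.
Qed.

Lemma inverseP (A B : C) (f : Hom A B) (g : Hom B A) :
  inverse f g <-> μ g @@ μ f = ι A /\ μ f @@ μ g = ι B.
Proof.
rewrite -!compE; split=> [[-> ->] //|[e e']].
by split; apply: Arrow_inj.
Qed.

Lemma tensor_braid_intertwining X Y
    (s : Hom (X ⊗ P) (P ⊗ X)) (t : Hom (Y ⊗ P) (P ⊗ Y)) :
  intertwining s -> intertwining t -> intertwining (tensor_braid s t).
Proof.
move=> [s' [/inverseP[s1 s2] /inverseP[bs1 bs2]]].
move=> [t' [/inverseP[t1 t2] /inverseP[bt1 bt2]]].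
pose st' : Hom (P ⊗ (X ⊗ Y)) (X ⊗ Y ⊗ P) :=
  cast! ((idm X ⊠ t') ∘! (s' ⊠ idm Y)).
have est' : μ st' = (ι X ** μ t') @@ (μ s' ** ι Y) by rewrite hom_castE comp_alongE.
have est : μ (tensor_braid s t) = (μ s ** ι Y) @@ (ι X ** μ t).
  by rewrite hom_castE comp_alongE.
(* two-layer composites of inverse layers cancel *)
have cancel (g g' f f' : Arrow C) (A : C) :
    cod f = dom g -> cod g = dom g' -> cod g' = dom f' ->
    g' @@ g = ι (dom g) -> f' @@ f = ι (dom f) -> A = dom f ->
  (f' @@ g') @@ (g @@ f) = ι A.
  move=> c1 c2 c3 eg ef ->.
  rewrite -acompA ?cod_acomp ?dom_acomp // (acompA c1 c2) eg.
  by rewrite acomp_idl.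
have cx (Z D B : C) (f : Hom D B) (g : Hom B D) : μ g @@ μ f = ι D ->
    (ι Z ** μ g) @@ (ι Z ** μ f) = ι (Z ⊗ D).
  by move=> e; rewrite -acomp_ten1 // e aten_id.
have cy (Z D B : C) (f : Hom D B) (g : Hom B D) : μ g @@ μ f = ι D ->
    (μ g ** ι Z) @@ (μ f ** ι Z) = ι (D ⊗ Z).
  by move=> e; rewrite -acomp_ten2 // e aten_id.
exists st'; split; apply/inverseP; rewrite ?bendQ_tensor ?(bendQ_inv_tensor est') ?est ?est'.
- by split; (apply: cancel; first [by apply: cx | by apply: cy | by objs]).
- by split; (apply: cancel; first [by apply: cx | by apply: cy | by objs]).
Qed.

Lemma unit_braid_intertwining : intertwining (unit_braid p).
Proof.
pose t : Hom (P ⊗ 𝟙) (𝟙 ⊗ P) := cast! (idm P).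
exists t; split; apply/inverseP.
  by rewrite !hom_castE -/(aid P) acomp_idl // ten1o teno1.
have zag : (μ (ev p) ** ι Q) @@ (ι Q ** μ (coev p)) = ι Q.
  by have := ev_coev_Q p; rewrite comp_alongE.
have zag' : (ι Q ** μ (rev p)) @@ (μ (rcoev p) ** ι Q) = ι Q.
  by have := rev_rcoev_Q p; rewrite comp_alongE.
have -> : μ (bendQ (unit_braid p)) = ι Q.
  rewrite bendQE hom_castE -/(aid P) !aten_id !aten1r.
  rewrite teno1 -acompA; try by objs.
  by rewrite acomp_idl //; objs.
have -> : μ (bendQ_inv t) = ι Q.
  rewrite bendQ_invE hom_castE -/(aid P) !aten_id !aten1r.
  rewrite teno1 -acompA; try by objs.
  by rewrite acomp_idl //; objs.
by rewrite acomp_idl // ten1o teno1.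
Qed.
End TensorIntertwining.

Section Intertwined.
Variables (J : Category) (C : StrictMonoidal) (D : PivotalDiagram J C).

Definition diag_mor (i i' : J) (f : Hom i i') :
  Hom (pivP (D i)) (pivP (D i')) := fmap D f.

Record IntertwinedObject := {
  io_ob :> C;
  io_braid : forall i : J, Hom (io_ob ⊗ pivP (D i)) (pivP (D i) ⊗ io_ob);
  io_intertwining : forall i, intertwining (io_braid i);
  io_natural : forall (i i' : J) (f : Hom i i'),
    (diag_mor f ⊠ idm io_ob) ∘ io_braid i
    = io_braid i' ∘ (idm io_ob ⊠ diag_mor f)
}.

Record IntertwinedHom (X Y : IntertwinedObject) := {
  ih_mor :> Hom (io_ob X) (io_ob Y);
  ih_comm : forall i : J,
    io_braid Y i ∘ (ih_mor ⊠ idm (pivP (D i)))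
    = (idm (pivP (D i)) ⊠ ih_mor) ∘ io_braid X i
}.

Lemma IntertwinedHom_eq (X Y : IntertwinedObject) (f g : IntertwinedHom X Y) :
  ih_mor f = ih_mor g -> f = g.
Proof.
case: f g => [f cf] [g cg] /= e; case: _ / e cg => cg.
by rewrite (proof_irrelevance _ cf cg).
Qed.

Program Definition ih_id (X : IntertwinedObject) : IntertwinedHom X X :=
  {| ih_mor := idm (io_ob X) |}.
Next Obligation. by rewrite !tenm_id comp_idl comp_idr. Qed.

Program Definition ih_comp (X Y Z : IntertwinedObject)
    (g : IntertwinedHom Y Z) (f : IntertwinedHom X Y) : IntertwinedHom X Z :=
  {| ih_mor := ih_mor g ∘ ih_mor f |}.
Next Obligation.
rewrite -[idm _](comp_idl (idm (pivP (D i)))) !tenm_comp.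
by rewrite compA ih_comm -!compA ih_comm.
Qed.

Program Definition IntertwinedCategory : Category := {|
  Ob := IntertwinedObject; Hom := IntertwinedHom; idm := ih_id; comp := ih_comp
|}.
Next Obligation. by apply: IntertwinedHom_eq; apply: comp_idl. Qed.
Next Obligation. by apply: IntertwinedHom_eq; apply: comp_idr. Qed.
Next Obligation. by apply: IntertwinedHom_eq; apply: compA. Qed.

Program Definition io_one : IntertwinedObject :=
  {| io_ob := 𝟙; io_braid i := unit_braid (D i) |}.
Next Obligation. exact: unit_braid_intertwining. Qed.
Next Obligation.
apply: Arrow_inj; rewrite !compE !hom_castE !atenE -!/(aid _) aten1l aten1r.
by rewrite acomp_idl // acomp_idr.
Qed.

Program Definition io_ten (X Y : IntertwinedObject) : IntertwinedObject :=
  {| io_ob := io_ob X ⊗ io_ob Y;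
     io_braid i := tensor_braid (io_braid X i) (io_braid Y i) |}.
Next Obligation. by apply: tensor_braid_intertwining; apply: io_intertwining. Qed.
Next Obligation.
have nX : acomp (aten (MkArrow (diag_mor f)) (aid (io_ob X))) (MkArrow (io_braid X i))
   = acomp (MkArrow (io_braid X i')) (aten (aid (io_ob X)) (MkArrow (diag_mor f))).
  by rewrite /aid -!atenE -!compE io_natural.
have nY : acomp (aten (MkArrow (diag_mor f)) (aid (io_ob Y))) (MkArrow (io_braid Y i))
   = acomp (MkArrow (io_braid Y i')) (aten (aid (io_ob Y)) (MkArrow (diag_mor f))).
  by rewrite /aid -!atenE -!compE io_natural.
apply: Arrow_inj; rewrite !compE !hom_castE !comp_alongE !atenE -!/(aid _).
rewrite -!aten_id acompA; try by objs.
rewrite atenA -acomp_ten2 // nX acomp_ten2 // -acompA; try by objs.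
rewrite -[aten (aten (aid (io_ob X)) _) _]atenA -acomp_ten1 // nY acomp_ten1 //.
by rewrite acompA ?atenA; objs.
Qed.

Program Definition ih_ten (X Y X' Y' : IntertwinedObject)
    (f : IntertwinedHom X Y) (f' : IntertwinedHom X' Y') :
    IntertwinedHom (io_ten X X') (io_ten Y Y') :=
  {| ih_mor := ih_mor f ⊠ ih_mor f' |}.
Next Obligation.
have cf : acomp (MkArrow (io_braid Y i)) (aten (MkArrow f) (aid (pivP (D i))))
   = acomp (aten (aid (pivP (D i))) (MkArrow f)) (MkArrow (io_braid X i)).
  by rewrite /aid -!atenE -!compE ih_comm.
have cf' : acomp (MkArrow (io_braid Y' i)) (aten (MkArrow f') (aid (pivP (D i))))
   = acomp (aten (aid (pivP (D i))) (MkArrow f')) (MkArrow (io_braid X' i)).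
  by rewrite /aid -!atenE -!compE ih_comm.
apply: Arrow_inj; rewrite !compE !hom_castE !comp_alongE !atenE -!/(aid _).
rewrite -acompA; try by objs.
rewrite -[aten (aten _ _) (aid _)]atenA -aten_comp // acomp_idl // cf'.
rewrite -[MkArrow f in LHS](acomp_idr (A := io_ob X)) //.
rewrite aten_comp // acompA; try by objs.
rewrite atenA -aten_comp // cf.
rewrite acomp_idl // -[MkArrow f' in LHS](acomp_idr (A := io_ob X')) //.
by rewrite aten_comp // -acompA ?atenA; objs.
Qed.

Lemma IntertwinedObject_eq (X Y : IntertwinedObject) :
    io_ob X = io_ob Y -> (forall i, io_braid X i ≈ io_braid Y i) -> X = Y.
Proof.
case: X Y => [X s sp sn] [Y t tp tn] /= e; case: _ / e t tp tn => t tp tn est.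
have e : s = t by apply: functional_extensionality_dep => i; apply: Arrow_inj.
case: _ / e tp tn {est} => tp tn.
by rewrite (proof_irrelevance _ sp tp) (proof_irrelevance _ sn tn).
Qed.

Lemma IntertwinedHom_arrow (X Y X' Y' : IntertwinedCategory)
    (f : Hom X Y) (f' : Hom X' Y') :
  X = X' -> Y = Y' -> ih_mor f ≈ ih_mor f' -> f ≈ f'.
Proof.
move=> eX eY; case: _ / eX f' => f'; case: _ / eY f' => f' /Arrow_inj e.
by rewrite (IntertwinedHom_eq e).
Qed.

Lemma io_tenA X Y Z : io_ten X (io_ten Y Z) = io_ten (io_ten X Y) Z.
Proof.
apply: IntertwinedObject_eq => [|i] /=; first exact: tenA.
rewrite !hom_castE !comp_alongE !atenE -!/(aid _) !hom_castE !comp_alongE.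
rewrite !atenE -!/(aid _) acomp_ten1 ?acomp_ten2 ?acompA; try by objs.
by rewrite -!aten_id !atenA.
Qed.

Lemma io_ten1o X : io_ten io_one X = X.
Proof.
apply: IntertwinedObject_eq => [|i] /=; first exact: ten1o.
rewrite hom_castE comp_alongE !atenE hom_castE -!/(aid _) aten1l aten_id.
by rewrite acomp_idl.
Qed.

Lemma io_teno1 X : io_ten X io_one = X.
Proof.
apply: IntertwinedObject_eq => [|i] /=; first exact: teno1.
rewrite hom_castE comp_alongE !atenE hom_castE -!/(aid _) aten1r aten_id.
by rewrite acomp_idr.
Qed.

Program Definition IntertwinedMonoidal : StrictMonoidal := {|
  sm_cat := IntertwinedCategory;
  one := io_one;
  ten := io_ten;
  tenm := ih_ten
|}.
Next Obligation. by apply: IntertwinedHom_eq; apply: tenm_id. Qed.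
Next Obligation. by apply: IntertwinedHom_eq; apply: tenm_comp. Qed.
Next Obligation. exact: io_tenA. Qed.
Next Obligation. exact: io_ten1o. Qed.
Next Obligation. exact: io_teno1. Qed.
Next Obligation.
by apply: IntertwinedHom_arrow; [exact: io_tenA|exact: io_tenA|exact: tenmA].
Qed.
Next Obligation.
by apply: IntertwinedHom_arrow; [exact: io_ten1o|exact: io_ten1o|exact: tenm1l].
Qed.
Next Obligation.
by apply: IntertwinedHom_arrow; [exact: io_teno1|exact: io_teno1|exact: tenm1r].
Qed.

Definition forgetful_functor : Functor IntertwinedMonoidal C :=
  @Build_Functor IntertwinedMonoidal C io_ob (fun X Y f => ih_mor f)
    (fun _ => erefl) (fun _ _ _ _ _ => erefl).

Definition forgetful : StrictMonoidalFunctor IntertwinedMonoidal C :=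
  @Build_StrictMonoidalFunctor IntertwinedMonoidal C forgetful_functor
    erefl (fun _ _ => erefl) (fun _ _ _ _ _ _ => erefl).

End Intertwined.

(* Main.v *)
From mathcomp Require Import ssreflect ssrfun ssrbool.
From Stdlib Require Import ProofIrrelevance FunctionalExtensionality ClassicalEpsilon.
Require Import Defs.

(** Let [(A, a)] and [(Y, y)] be intertwined objects, let [H] be the inner
    hom from [A] to [Y] (left closed case) and let [e : H ⊗ A -> Y] be the evaluation.  The pair [(H, e)]
    is universal: morphisms [X -> H] are morphisms [X ⊗ A -> Y].  Duality moves
    universality along the objects of a pivotal pair [(P, Q)]:
    - [P ⊗ e] exhibits [P ⊗ H] as the inner hom from [A] to [P ⊗ Y],
      because [Q] is left dual to [P] ([universal_tensor_left]);
    - [(e ⊗ P) (H ⊗ a^-1)] exhibits [H ⊗ P] as the inner hom from [A] to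
      [Y ⊗ P], because [Q] is right dual to [P] and [A] can be moved past [Q]
      by the bent braiding ([universal_tensor_right]).
    Since [y] identifies [Y ⊗ P] with [P ⊗ Y], the two universal objects are
    related by a unique isomorphism [s : H ⊗ P -> P ⊗ H] that makes [e] a
    morphism of intertwined objects.  The roles of [P] and [Q] may be exchanged,
    so [Q ⊗ H] and [H ⊗ Q] are universal as well.  Bending is natural and
    compatible with tensor products, hence the two bent forms of [s] are the
    comparison morphisms of these universal objects in the two directions, and
    are inverse to each other.  This is the pivotal condition for [s]
    ([hom_braiding]).

    Everything else follows from the injectivity part of universality.  If the
    transpose [e (u ⊗ A)] of [u : X -> H] is compatible with braidings, so is
    [u]; allowing at the same time a morphism [f : P -> P'] of the diagram gives
    one statement ([crosses_of_eval]) that yields the naturality of [s] in the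
    diagram, the functoriality of the inner hom and the fact that the units are
    morphisms.  The adjunction identities are then those of the base category,
    so the structure lifts on the nose and the comparison morphism of the
    forgetful functor is an identity by a triangle identity.

    The right closed case is the left closed one in the category with the
    reversed tensor product, where a braiding is replaced by its inverse
    ([reverse], [reverse_pair], [intertwining_reverse]). *)

Set Implicit Arguments.
Unset Strict Implicit.
Unset Printing Implicit Defensive.
Local Open Scope cat_scope.
Local Notation "'ι' X" := (aid X) (at level 10).
Local Notation "'μ' f" := (MkArrow f) (at level 10).
Local Infix "**" := aten (at level 34, left associativity).
Local Infix "@@" := acomp (at level 40, left associativity).

(** * Reversing the tensor product and transposing along duals *)

Program Definition reverse (C : StrictMonoidal) : StrictMonoidal := {|
  sm_cat := sm_cat C;
  one := one;
  ten X Y := Y ⊗ X;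
  tenm A B A' B' f g := g ⊠ f
|}.
Next Obligation. exact: tenm_id. Qed.
Next Obligation. exact: tenm_comp. Qed.
Next Obligation. exact: esym (tenA _ _ _). Qed.
Next Obligation. exact: teno1. Qed.
Next Obligation. exact: ten1o. Qed.
Next Obligation. exact: esym (tenmA _ _ _). Qed.
Next Obligation. exact: tenm1r. Qed.
Next Obligation. exact: tenm1l. Qed.

(** The bijection between [X -> P ⊗ Z] and [Q ⊗ X -> Z] given by a coevaluation [c]
    and an evaluation [d]: one zigzag identity makes it injective, the other
    surjective.  The bijection between [X -> Z ⊗ P] and [X ⊗ Q -> Z] is its
    instance in [reverse C]. *)
Section Duals.
Variables (C : StrictMonoidal) (P Q : C).
Variables (c : Hom 𝟙 (P ⊗ Q)) (d : Hom (Q ⊗ P) 𝟙).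

Definition transpose X Z (f : Hom X (P ⊗ Z)) : Hom (Q ⊗ X) Z :=
  cast! ((d ⊠ idm Z) ∘! (idm Q ⊠ f)).

Lemma transposeE X Z (f : Hom X (P ⊗ Z)) :
  μ (transpose f) = (μ d ** ι Z) @@ (ι Q ** μ f).
Proof. by rewrite hom_castE comp_alongE. Qed.

Lemma transpose_inj X Z (f g : Hom X (P ⊗ Z)) :
    (ι P ** μ d) @@ (μ c ** ι P) = ι P ->
  transpose f = transpose g -> f = g.
Proof.
move=> zig.
have E (h : Hom X (P ⊗ Z)) :
    (ι P ** μ (transpose h)) @@ (μ c ** ι X) = μ h.
  rewrite transposeE acomp_ten1; try by objs.
  rewrite -acompA; try by objs.
  rewrite [ι P ** (ι Q ** _)]atenA aten_id.
  rewrite (slide (f := μ c) (A := 𝟙) (B' := P ⊗ Z)); try by objs.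
  rewrite aten1l acompA; try by objs.
  rewrite -aten_id !atenA -acomp_ten2; try by objs.
  by rewrite zig aten_id acomp_idl.
by move=> e; apply: Arrow_inj; rewrite -E e E.
Qed.

Lemma transpose_surj X Z (u : Hom (Q ⊗ X) Z) :
    (μ d ** ι Q) @@ (ι Q ** μ c) = ι Q ->
  exists f, transpose f = u.
Proof.
move=> zag.
exists (cast! ((idm P ⊠ u) ∘! (c ⊠ idm X))).
apply: Arrow_inj; rewrite transposeE hom_castE comp_alongE !atenE -!/(aid _).
rewrite acomp_ten1; try by objs.
rewrite [ι Q ** (ι P ** _)]atenA aten_id acompA; try by objs.
rewrite -(slide (f := μ d) (A' := 𝟙) (B := Q ⊗ X)); try by objs.
rewrite aten1l -acompA; try by objs.
rewrite -aten_id !atenA -acomp_ten2; try by objs.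
by rewrite zag aten_id acomp_idr.
Qed.
End Duals.

(** * Universal evaluations *)

(** The left closed condition at one pair of objects, as a property of the
    evaluation: [e] exhibits [H] as the left inner hom
    from [A] to [Y]. *)
Definition universal (C : StrictMonoidal) (A Y H : C) (e : Hom (H ⊗ A) Y) : Prop :=
  forall X (g : Hom (X ⊗ A) Y), exists! u : Hom X H, e ∘ (u ⊠ idm A) = g.

Lemma universal_inj (C : StrictMonoidal) (A Y H X : C) (e : Hom (H ⊗ A) Y)
    (f g : Hom X H) :
  universal e -> e ∘ (f ⊠ idm A) = e ∘ (g ⊠ idm A) -> f = g.
Proof. by move=> /(_ X (e ∘ (f ⊠ idm A)))[u [_ uu]] efg; rewrite -(uu f) // -(uu g). Qed.

(** Both composites transpose to an evaluation, so each is an identity by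
    uniqueness.  Used for the braiding of the inner hom, and again for its two
    bent forms, where invertibility is the pivotal condition. *)
Lemma inverse_of_universal (C : StrictMonoidal) (A Y Y' H H' : C)
    (e : Hom (H ⊗ A) Y) (e' : Hom (H' ⊗ A) Y') (t : Hom Y Y') (t' : Hom Y' Y)
    (s : Hom H H') (s' : Hom H' H) :
    universal e -> universal e' -> inverse t t' ->
    e' ∘ (s ⊠ idm A) = t ∘ e -> e ∘ (s' ⊠ idm A) = t' ∘ e' ->
  inverse s s'.
Proof.
move=> ue ue' [t't tt'] es es'.
have ten_comp D1 D2 D3 (g : Hom D2 D3) (f : Hom D1 D2) :
    (g ∘ f) ⊠ idm A = (g ⊠ idm A) ∘ (f ⊠ idm A).
  by rewrite -tenm_comp comp_idl.
split; [apply: (universal_inj ue)|apply: (universal_inj ue')].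
  by rewrite tenm_id comp_idr ten_comp compA es' -compA es compA t't comp_idl.
by rewrite tenm_id comp_idr ten_comp compA es -compA es' compA tt' comp_idl.
Qed.

Section UniversalTensor.
Variables (C : StrictMonoidal) (A Y H : C) (e : Hom (H ⊗ A) Y).
Hypothesis ue : universal e.

(** Transposing along the duality turns [(P ⊗ e) (f ⊗ A)] into [e (f' ⊗ A)], with
    [f'] the transpose of [f]; so [P ⊗ e] inherits universality from [e]. *)
Lemma universal_tensor_left (P Q : C) (c : Hom 𝟙 (P ⊗ Q)) (d : Hom (Q ⊗ P) 𝟙) :
    (ι P ** μ d) @@ (μ c ** ι P) = ι P -> (μ d ** ι Q) @@ (ι Q ** μ c) = ι Q ->
  universal (cast! (idm P ⊠ e) : Hom (P ⊗ H ⊗ A) (P ⊗ Y)).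
Proof.
move=> zig zag; set pe := (X in universal X).
have peE : μ pe = ι P ** μ e by rewrite hom_castE.
have trE X (f : Hom X (P ⊗ H)) :
    μ (transpose d (pe ∘ (f ⊠ idm A))) = μ e @@ (μ (transpose d f) ** ι A).
  rewrite !transposeE compE peE atenE -/(aid A) acomp_ten1; try by objs.
  rewrite acompA; try by objs.
  rewrite [ι Q ** (ι P ** _)]atenA aten_id.
  rewrite -(slide (f := μ d) (A' := 𝟙) (B := H ⊗ A)); try by objs.
  rewrite aten1l -acompA; try by objs.
  rewrite acomp_ten2; try by objs.
  by rewrite -aten_id !atenA.
move=> X g.
have [u0 [eu0 _]] := ue (hom_cast (transpose d g) (tenA _ _ _) erefl).
have [f tf] := transpose_surj u0 zag.
exists f; split=> [|f' ef'].
  apply: (transpose_inj zig); apply: Arrow_inj.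
  by rewrite trE tf -atenE -compE eu0 hom_castE.
apply: (transpose_inj zig); rewrite tf.
apply: (universal_inj ue); apply: Arrow_inj.
by rewrite eu0 hom_castE compE atenE -trE ef'.
Qed.

(** Transposing a morphism [X ⊗ A -> Y ⊗ R] produces [X ⊗ A ⊗ S -> Y], with [S] on
    the wrong side of [A] for the universality of [e]; the isomorphism [l]
    exchanges the two.  The last hypothesis, that [A] slides past the counit [d],
    makes this exchange match the one that [k] performs on [R]. *)
Lemma universal_tensor_right (R S : C) (c : Hom 𝟙 (S ⊗ R)) (d : Hom (R ⊗ S) 𝟙)
    (k : Hom (R ⊗ A) (A ⊗ R)) (l : Hom (S ⊗ A) (A ⊗ S)) (l' : Hom (A ⊗ S) (S ⊗ A)) :
    (μ d ** ι R) @@ (ι R ** μ c) = ι R -> (ι S ** μ d) @@ (μ c ** ι S) = ι S ->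
    inverse l l' ->
    (ι A ** μ d) @@ (μ k ** ι S) @@ (ι R ** μ l) = μ d ** ι A ->
  universal (cast! ((e ⊠ idm R) ∘! (idm H ⊠ k)) : Hom (H ⊗ R ⊗ A) (Y ⊗ R)).
Proof.
move=> zig zag [_ ll'] kl; set er := (X in universal X).
have erE : μ er = (μ e ** ι R) @@ (ι H ** μ k) by rewrite hom_castE comp_alongE.
pose tr X Z (f : Hom X (Z ⊗ R)) : Hom (X ⊗ S) Z := @transpose (reverse C) R S d X Z f.
have trE0 X Z (f : Hom X (Z ⊗ R)) : μ (tr _ _ f) = (ι Z ** μ d) @@ (μ f ** ι S).
  exact: (@transposeE (reverse C)).
have tr_inj X Z (f g : Hom X (Z ⊗ R)) : tr _ _ f = tr _ _ g -> f = g.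
  exact: (@transpose_inj (reverse C) R S c d X Z f g zig).
have ll X : (ι X ** μ l) @@ (ι X ** μ l') = ι (X ⊗ (A ⊗ S)).
  by rewrite -acomp_ten1 // -compE ll' aten_id.
have trE X (f : Hom X (H ⊗ R)) :
    μ (tr _ _ (er ∘ (f ⊠ idm A))) @@ (ι X ** μ l) = μ e @@ (μ (tr _ _ f) ** ι A).
  rewrite !trE0 compE erE atenE -/(aid A) !acomp_ten2; try by objs.
  rewrite -[ι H ** μ d ** ι A]atenA -kl !acomp_ten1; try by objs.
  rewrite !acompA; try by objs.
  have -> : μ e @@ (ι H ** (ι A ** μ d)) = (ι Y ** μ d) @@ (μ e ** ι R ** ι S).
    rewrite -[μ e in LHS]aten1r atenA -[μ e ** _ ** _]atenA !aten_id.
    by rewrite (slide (f := μ e) (A := H ⊗ A) (B' := 𝟙)).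
  rewrite -[RHS]acompA; try by objs.
  have -> : (ι H ** (ι R ** μ l)) @@ (μ f ** ι S ** ι A)
            = (μ f ** ι A ** ι S) @@ (ι X ** μ l).
    rewrite atenA -[μ f ** _ ** _]atenA -[μ f ** ι A ** _]atenA !aten_id.
    by rewrite (slide (f := μ f) (A := X) (B' := A ⊗ S)).
  by rewrite !acompA ?atenA; objs.
move=> X g.
have [u0 [eu0 _]] := ue (cast! (tr _ _ g ∘! (idm X ⊠ l)) : Hom (X ⊗ S ⊗ A) Y).
have mu0 : μ e @@ (μ u0 ** ι A) = μ (tr _ _ g) @@ (ι X ** μ l).
  by rewrite -atenE -compE eu0 hom_castE comp_alongE.
have [f tf] : exists f, tr X H f = u0 := @transpose_surj (reverse C) R S c d X H u0 zag.
have cancel_l (h h' : Hom (X ⊗ A) (Y ⊗ R)) :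
    μ (tr _ _ h) @@ (ι X ** μ l) = μ (tr _ _ h') @@ (ι X ** μ l) -> h = h'.
  move=> ehh; apply: tr_inj; apply: Arrow_inj.
  have := congr1 (fun a => a @@ (ι X ** μ l')) ehh.
  by rewrite -!acompA ?ll ?acomp_idr; objs.
exists f; split=> [|f' ef']; first by apply: cancel_l; rewrite trE tf.
apply: tr_inj; rewrite tf; apply: (universal_inj ue); apply: Arrow_inj.
by rewrite compE atenE mu0 -ef' trE compE.
Qed.
End UniversalTensor.

(** * Braidings in a pivotal category *)

(** The common form of both compatibility conditions on intertwined objects:
    [u] is a morphism when [f] is an identity, and the braiding is natural in the
    diagram when [u] is an identity. *)
Definition crosses (C : StrictMonoidal) (P P' X Y : C) (f : Hom P P') (u : Hom X Y)
    (s : Hom (X ⊗ P) (P ⊗ X)) (s' : Hom (Y ⊗ P') (P' ⊗ Y)) : Prop :=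
  s' ∘ (u ⊠ f) = (f ⊠ u) ∘ s.

Lemma crossesP (C : StrictMonoidal) (P P' X Y : C) (f : Hom P P') (u : Hom X Y)
    (s : Hom (X ⊗ P) (P ⊗ X)) (s' : Hom (Y ⊗ P') (P' ⊗ Y)) :
  crosses f u s s' <-> μ s' @@ (μ u ** μ f) = (μ f ** μ u) @@ μ s.
Proof.
rewrite /crosses -!atenE -!compE; split=> [->//|]; exact: Arrow_inj.
Qed.

(** Left duals become right duals under reversal, so the two dualities of the pair
    trade places. *)
Program Definition reverse_pair (C : StrictMonoidal) (p : PivotalPair C) :
    PivotalPair (reverse C) :=
  {| pivP := pivP p : reverse C; pivQ := pivQ p; coev := rcoev p; ev := rev p;
     rcoev := coev p; rev := ev p |}.
Next Obligation. by rewrite -(rev_rcoev_Q p) !comp_alongE. Qed.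
Next Obligation. by rewrite -(rev_rcoev_P p) !comp_alongE. Qed.
Next Obligation. by rewrite -(ev_coev_P p) !comp_alongE. Qed.
Next Obligation. by rewrite -(ev_coev_Q p) !comp_alongE. Qed.

Section Bending.
Variables (C : StrictMonoidal) (p : PivotalPair C).
Local Notation P := (pivP p).
Local Notation Q := (pivQ p).

Lemma ev_coev_PE : (ι P ** μ (ev p)) @@ (μ (coev p) ** ι P) = ι P.
Proof. by have := ev_coev_P p; rewrite comp_alongE. Qed.
Lemma ev_coev_QE : (μ (ev p) ** ι Q) @@ (ι Q ** μ (coev p)) = ι Q.
Proof. by have := ev_coev_Q p; rewrite comp_alongE. Qed.
Lemma rev_rcoev_PE : (μ (rev p) ** ι P) @@ (ι P ** μ (rcoev p)) = ι P.
Proof. by have := rev_rcoev_P p; rewrite comp_alongE. Qed.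
Lemma rev_rcoev_QE : (ι Q ** μ (rev p)) @@ (μ (rcoev p) ** ι Q) = ι Q.
Proof. by have := rev_rcoev_Q p; rewrite comp_alongE. Qed.

(** Read backwards, bending an inverse braiding with the right duality is
    bending with the left one.  This is what makes [bendQ_inv_crosses] an instance
    of [bendQ_crosses]. *)
Lemma bendQ_reverse (X : C) (t : Hom (P ⊗ X) (X ⊗ P)) :
  @bendQ (reverse C) (reverse_pair p) X t = bendQ_inv t.
Proof.
apply: (@Arrow_inj C); rewrite [RHS]bendQ_invE.
rewrite -[_ ** ι X ** ι Q]atenA -[ι Q ** μ t ** ι Q]atenA -[ι Q ** ι X ** _]atenA.
exact: (@bendQE (reverse C)).
Qed.

Lemma bendQ_inv_reverse (X : C) (s : Hom (X ⊗ P) (P ⊗ X)) :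
  @bendQ_inv (reverse C) (reverse_pair p) X s = bendQ s.
Proof.
apply: (@Arrow_inj C); rewrite [RHS]bendQE.
rewrite -[_ ** ι X ** ι Q]atenA -[ι Q ** μ s ** ι Q]atenA -[ι Q ** ι X ** _]atenA.
exact: (@bendQ_invE (reverse C)).
Qed.

(** The counterpart for [ev] of [rev_bendQ_inv]: bending is designed so that [X]
    slides past the counit.  One zigzag cancels the coevaluation used to bend. *)
Lemma ev_bendQ (X : C) (s : Hom (X ⊗ P) (P ⊗ X)) :
  (ι X ** μ (ev p)) @@ (μ (bendQ s) ** ι P) = (μ (ev p) ** ι X) @@ (ι Q ** μ s).
Proof.
rewrite bendQE !acomp_ten2; try by objs.
rewrite !acompA; try by objs.
have -> : μ (ev p) ** ι X ** ι Q ** ι P = (μ (ev p) ** ι X) ** ι (Q ⊗ P).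
  by rewrite -aten_id !atenA.
rewrite (slide (f := μ (ev p) ** ι X) (A := Q ⊗ (P ⊗ X)) (B' := 𝟙)); try by objs.
rewrite aten1r -(acompA (h := μ (ev p) ** ι X)); try by objs.
have -> : ι Q ** μ s ** ι Q ** ι P = (ι Q ** μ s) ** ι (Q ⊗ P).
  by rewrite -aten_id !atenA.
rewrite (slide (f := ι Q ** μ s) (A := Q ⊗ (X ⊗ P)) (B' := 𝟙)); try by objs.
rewrite aten1r -!acompA; try by objs.
rewrite -!aten_id !atenA -[ι Q ** ι X ** ι P ** _]atenA -[ι Q ** ι X ** _ ** ι P]atenA.
rewrite !(aten_id Q X) -acomp_ten1; try by objs.
by rewrite ev_coev_PE !aten_id acomp_idr //; objs.
Qed.

(** Slide [u] through the coevaluation, the braiding and the evaluation. *)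
Lemma bendQ_crosses (X Y : C) (u : Hom X Y)
    (s : Hom (X ⊗ P) (P ⊗ X)) (s' : Hom (Y ⊗ P) (P ⊗ Y)) :
  crosses (idm P) u s s' ->
  μ (bendQ s') @@ (ι Q ** μ u) = (μ u ** ι Q) @@ μ (bendQ s).
Proof.
move=> /crossesP; rewrite -/(aid P) => us.
rewrite !bendQE -acompA; try by objs.
have -> : (ι Q ** ι Y ** μ (coev p)) @@ (ι Q ** μ u)
          = (ι Q ** μ u ** ι (P ⊗ Q)) @@ (ι Q ** ι X ** μ (coev p)).
  rewrite -[ι Q ** μ u in LHS]aten1r !aten_id.
  by rewrite (slide (f := ι Q ** μ u) (A := Q ⊗ X) (B' := P ⊗ Q)).
rewrite acompA; try by objs.
rewrite -(acompA (f := ι Q ** μ u ** ι (P ⊗ Q))); try by objs.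
have -> : (ι Q ** μ s' ** ι Q) @@ (ι Q ** μ u ** ι (P ⊗ Q))
          = (ι (Q ⊗ P) ** (μ u ** ι Q)) @@ (ι Q ** μ s ** ι Q).
  rewrite -!aten_id !atenA -acomp_ten2; try by objs.
  by rewrite -(atenA (ι Q)) -acomp_ten1 // us acomp_ten1 ?acomp_ten2 ?atenA; objs.
rewrite !acompA; try by objs.
rewrite -[μ (ev p) ** _ ** _]atenA aten_id.
rewrite -(slide (f := μ (ev p)) (A' := 𝟙) (B := X ⊗ Q)); try by objs.
by rewrite aten1l -(aten_id X Q) atenA.
Qed.
End Bending.

Lemma bendQ_inv_crosses (C : StrictMonoidal) (p : PivotalPair C) (X Y : C)
    (u : Hom X Y) (t : Hom (pivP p ⊗ X) (X ⊗ pivP p))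
    (t' : Hom (pivP p ⊗ Y) (Y ⊗ pivP p)) :
  μ t' @@ (ι (pivP p) ** μ u) = (μ u ** ι (pivP p)) @@ μ t ->
  μ (bendQ_inv t') @@ (μ u ** ι (pivQ p)) = (ι (pivQ p) ** μ u) @@ μ (bendQ_inv t).
Proof.
move=> ut; rewrite -!bendQ_reverse.
by apply: (@bendQ_crosses (reverse C) (reverse_pair p)); apply/crossesP.
Qed.

Lemma tensor_braidE (C : StrictMonoidal) (p : PivotalPair C) (X Y : C)
    (s : Hom (X ⊗ pivP p) (pivP p ⊗ X)) (t : Hom (Y ⊗ pivP p) (pivP p ⊗ Y)) :
  μ (tensor_braid s t) = (μ s ** ι Y) @@ (ι X ** μ t).
Proof. by rewrite hom_castE comp_alongE. Qed.

(** * The braiding of an inner hom *)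

(** The four morphisms [pe], [ep], [qe], [eq] of the proof are universal and
    exhibit [P ⊗ H], [H ⊗ P], [Q ⊗ H], [H ⊗ Q] as inner homs out of [A].  The
    braiding compares the first two; its bent forms compare the last two. *)
Lemma hom_braiding (C : StrictMonoidal) (p : PivotalPair C) (A Y H : C)
    (e : Hom (H ⊗ A) Y)
    (a : Hom (A ⊗ pivP p) (pivP p ⊗ A)) (y : Hom (Y ⊗ pivP p) (pivP p ⊗ Y)) :
    universal e -> intertwining a -> intertwining y ->
  exists s, intertwining s /\ crosses (idm (pivP p)) e (tensor_braid s a) y.
Proof.
set P := pivP p; set Q := pivQ p.
move=> ue [a' [aa' baa']] [y' [yy' byy']].
have [a'a_ aa'_] := (proj1 (inverseP _ _) aa').
have [ba'a_ baa'_] := (proj1 (inverseP _ _) baa').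
have uPe := universal_tensor_left ue (ev_coev_PE p) (ev_coev_QE p).
have uQe := universal_tensor_left ue (rev_rcoev_QE p) (rev_rcoev_PE p).
have ueP : universal (cast! ((e ⊠ idm P) ∘! (idm H ⊠ a')) : Hom (H ⊗ P ⊗ A) _).
  apply: (universal_tensor_right ue (rev_rcoev_PE p) (rev_rcoev_QE p) baa').
  rewrite -rev_bendQ_inv -acompA; try by objs.
  by rewrite -acomp_ten1 // ba'a_ aten_id acomp_idr //; objs.
have ueQ : universal (cast! ((e ⊠ idm Q) ∘! (idm H ⊠ bendQ a)) : Hom (H ⊗ Q ⊗ A) _).
  apply: (universal_tensor_right ue (ev_coev_QE p) (ev_coev_PE p) (l := a') (l' := a)).
    by case: aa'.
  rewrite ev_bendQ -acompA; try by objs.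
  by rewrite -acomp_ten1 // aa'_ aten_id acomp_idr //; objs.
have PeE : μ (cast! (idm P ⊠ e) : Hom (P ⊗ H ⊗ A) _) = ι P ** μ e by rewrite hom_castE.
have QeE : μ (cast! (idm Q ⊠ e) : Hom (Q ⊗ H ⊗ A) _) = ι Q ** μ e by rewrite hom_castE.
have ePE : μ (cast! ((e ⊠ idm P) ∘! (idm H ⊠ a')) : Hom (H ⊗ P ⊗ A) _)
  = (μ e ** ι P) @@ (ι H ** μ a') by rewrite hom_castE comp_alongE.
have eQE : μ (cast! ((e ⊠ idm Q) ∘! (idm H ⊠ bendQ a)) : Hom (H ⊗ Q ⊗ A) _)
  = (μ e ** ι Q) @@ (ι H ** μ (bendQ a)) by rewrite hom_castE comp_alongE.
move: PeE QeE ePE eQE uPe uQe ueP ueQ.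
set pe := hom_cast _ _ _; set qe := hom_cast _ _ _.
set ep := hom_cast _ _ _; set eq := hom_cast _ _ _.
move=> PeE QeE ePE eQE uPe uQe ueP ueQ.
have [s [es _]] := uPe _ (y ∘ ep).
have [s' [es' _]] := ueP _ (y' ∘ pe).
have ss' := inverse_of_universal ueP uPe yy' es es'.
have esE : μ pe @@ (μ s ** ι A) = μ y @@ μ ep by rewrite -[RHS]compE -es compE.
have es'E : μ ep @@ (μ s' ** ι A) = μ y' @@ μ pe by rewrite -[RHS]compE -es' compE.
have e_s : crosses (idm P) e (tensor_braid s a) y.
  apply/crossesP; rewrite tensor_braidE -/(aid P) -PeE acompA; try by objs.
  rewrite esE ePE -!acompA; try by objs.
  by rewrite -acomp_ten1 // a'a_ aten_id acomp_idr; objs.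
have e_s' : μ y' @@ (ι P ** μ e) = (μ e ** ι P) @@ ((ι H ** μ a') @@ (μ s' ** ι A)).
  by rewrite acompA -?ePE -?PeE ?es'E; objs.
exists s; split=> //; exists s'; split=> //.
(* it remains to see that the bent forms are the comparisons along [bendQ y] *)
apply: (inverse_of_universal uQe ueQ byy'); apply: Arrow_inj; rewrite !compE.
  rewrite QeE (bendQ_crosses e_s) bendQ_tensor eQE.
  by rewrite acompA; objs.
pose sa' : Hom (P ⊗ (H ⊗ A)) (H ⊗ A ⊗ P) := cast! ((idm H ⊠ a') ∘! (s' ⊠ idm A)).
have sa'E : μ sa' = (ι H ** μ a') @@ (μ s' ** ι A) by rewrite hom_castE comp_alongE.
rewrite -sa'E in e_s'; rewrite eQE QeE acompA; try by objs.
rewrite (bendQ_inv_crosses e_s') (bendQ_inv_tensor sa'E) -!acompA; try by objs.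
by rewrite -acomp_ten1 // ba'a_ aten_id acomp_idr; objs.
Qed.

(** By universality of [P' ⊗ e], both sides may be tested after tensoring with [A]
    and evaluating.  Precomposing with the isomorphism [X ⊗ a] turns the
    braiding of [X] into that of [X ⊗ A], and the hypotheses on [e], [A] and the
    transpose of [u] apply. *)
Lemma crosses_of_eval (C : StrictMonoidal) (p p' : PivotalPair C)
    (f : Hom (pivP p) (pivP p')) (A Y H X : C) (e : Hom (H ⊗ A) Y) (u : Hom X H)
    (x : Hom (X ⊗ pivP p) (pivP p ⊗ X)) (s : Hom (H ⊗ pivP p') (pivP p' ⊗ H))
    (a : Hom (A ⊗ pivP p) (pivP p ⊗ A)) (a' : Hom (A ⊗ pivP p') (pivP p' ⊗ A))
    (y : Hom (Y ⊗ pivP p') (pivP p' ⊗ Y)) :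
    universal e -> is_iso a ->
    crosses (idm (pivP p')) e (tensor_braid s a') y ->
    crosses f (idm A) a a' ->
    crosses f (e ∘ (u ⊠ idm A)) (tensor_braid x a) y ->
  crosses f u x s.
Proof.
set P := pivP p; set P' := pivP p'.
move=> ue [b /inverseP[_ ab]] /crossesP es /crossesP fa /crossesP feu.
rewrite tensor_braidE -/P' -/(aid P') in es.
rewrite tensor_braidE -/P -/P' compE atenE -!/(aid _) in feu.
rewrite -!/(aid _) in fa.
have uPe := universal_tensor_left ue (ev_coev_PE p') (ev_coev_QE p').
have PeE : μ (cast! (idm P' ⊠ e) : Hom (P' ⊗ H ⊗ A) _) = ι P' ** μ e by rewrite hom_castE.
apply: (universal_inj uPe); apply: Arrow_inj; rewrite !compE PeE !atenE !compE !atenE -/(aid A).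
have cancel (g h : Arrow C) : dom g = X ⊗ P ⊗ A -> dom h = X ⊗ P ⊗ A ->
    g @@ (ι X ** μ a) = h @@ (ι X ** μ a) -> g = h.
  move=> dg dh gh; have := congr1 (fun k => k @@ (ι X ** μ b)) gh.
  by rewrite /= -!acompA -?acomp_ten1 ?ab ?aten_id ?acomp_idr; objs; rewrite ?dg ?dh ?tenA.
apply: cancel; try by objs; objs.
(* both sides are [y] after the transpose of [u], tensored with [f] *)
transitivity (μ y @@ ((μ e @@ (μ u ** ι A)) ** μ f)).
  rewrite -[μ f in RHS](acomp_idl (A := P')) // aten_comp // acompA; try by objs.
  rewrite es acomp_ten2 // -!acompA; try by objs.
  congr (_ @@ (_ @@ _)).
  rewrite -[_ ** μ f ** _]atenA -[_ ** ι A ** μ f]atenA -!aten_comp // fa.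
  by rewrite acomp_idl // acomp_idr.
rewrite feu -[μ f in LHS](acomp_idl (A := P')) // aten_comp // acomp_ten2 //.
by rewrite -!acompA ?atenA; objs.
Qed.

(** * Transfer to the right closed case *)

Section Reverse.
Variables (C : StrictMonoidal) (p : PivotalPair C).
Local Notation P := (pivP p).

(** Both sides are about the same two pairs of mutually inverse morphisms, with
    the roles of a braiding and its inverse exchanged. *)
Lemma intertwining_reverse (X : C) (s : Hom (X ⊗ P) (P ⊗ X)) (t : Hom (P ⊗ X) (X ⊗ P)) :
  inverse s t -> intertwining s <-> @intertwining (reverse C) (reverse_pair p) X t.
Proof.
move=> [ts st]; split=> [[t' [[t's st'] [b1 b2]]]|[s' [[s't ts'] [b1 b2]]]].
  have et : t' = t by rewrite -(comp_idl t') -ts -compA st' comp_idr.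
  rewrite et in b1 b2; exists s; split=> //.
  by rewrite bendQ_reverse bendQ_inv_reverse.
have es : s' = s by rewrite -(comp_idl s') -[idm _]st -compA; rewrite [t ∘ s']ts' comp_idr.
rewrite es in b1 b2; exists t; split=> //.
by rewrite bendQ_reverse bendQ_inv_reverse in b1 b2.
Qed.

Lemma tensor_braid_reverse (X Y : C)
    (s : Hom (X ⊗ P) (P ⊗ X)) (s' : Hom (P ⊗ X) (X ⊗ P))
    (t : Hom (Y ⊗ P) (P ⊗ Y)) (t' : Hom (P ⊗ Y) (Y ⊗ P)) :
    inverse s s' -> inverse t t' ->
  inverse (tensor_braid s t) (@tensor_braid (reverse C) (reverse_pair p) Y X t' s').
Proof.
move=> /inverseP[s's ss'] /inverseP[t't tt']; apply/inverseP.
have -> : μ (@tensor_braid (reverse C) (reverse_pair p) Y X t' s')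
          = (ι X ** μ t') @@ (μ s' ** ι Y).
  exact: (@tensor_braidE (reverse C) (reverse_pair p) Y X t' s').
rewrite tensor_braidE; split.
  rewrite -acompA; try by objs.
  rewrite (acompA (g := μ s ** ι Y)); try by objs.
  by rewrite -acomp_ten2 // s's aten_id acomp_idl -?acomp_ten1 ?t't ?aten_id; objs.
rewrite -acompA; try by objs.
rewrite (acompA (g := ι X ** μ t')); try by objs.
by rewrite -acomp_ten1 // tt' aten_id acomp_idl -?acomp_ten2 ?ss' ?aten_id; objs.
Qed.
End Reverse.

Lemma crosses_reverse (C : StrictMonoidal) (P P' X Y : C) (f : Hom P P') (u : Hom X Y)
    (s : Hom (X ⊗ P) (P ⊗ X)) (t : Hom (P ⊗ X) (X ⊗ P))
    (s' : Hom (Y ⊗ P') (P' ⊗ Y)) (t' : Hom (P' ⊗ Y) (Y ⊗ P')) :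
    inverse s t -> inverse s' t' ->
  crosses f u s s' <-> @crosses (reverse C) P P' X Y f u t t'.
Proof.
rewrite /crosses /= => -[ts st] [t's' s't']; split=> e.
  by rewrite -[RHS]comp_idl -t's' -compA (compA s') e -!compA st comp_idr.
by rewrite -[RHS]comp_idl -s't' -compA (compA t') e -!compA ts comp_idr.
Qed.

Lemma hom_braiding_right (C : StrictMonoidal) (p : PivotalPair C) (A Y H : C)
    (e : Hom (A ⊗ H) Y)
    (a : Hom (A ⊗ pivP p) (pivP p ⊗ A)) (y : Hom (Y ⊗ pivP p) (pivP p ⊗ Y)) :
    @universal (reverse C) A Y H e -> intertwining a -> intertwining y ->
  exists s, intertwining s /\ crosses (idm (pivP p)) e (tensor_braid a s) y.
Proof.
move=> ue ia iy; have [a' [aa' _]] := ia; have [y' [yy' _]] := iy.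
have [t [it et]] := hom_braiding ue (proj1 (intertwining_reverse aa') ia)
                                    (proj1 (intertwining_reverse yy') iy).
have [s [[st ts] _]] := it; have ss : inverse s t by [].
exists s; split; first exact/(intertwining_reverse ss).
exact/(crosses_reverse _ _ (tensor_braid_reverse aa' ss) yy').
Qed.

Lemma crosses_of_eval_right (C : StrictMonoidal) (p p' : PivotalPair C)
    (f : Hom (pivP p) (pivP p')) (A Y H X : C) (e : Hom (A ⊗ H) Y) (u : Hom X H)
    (x : Hom (X ⊗ pivP p) (pivP p ⊗ X)) (s : Hom (H ⊗ pivP p') (pivP p' ⊗ H))
    (a : Hom (A ⊗ pivP p) (pivP p ⊗ A)) (a' : Hom (A ⊗ pivP p') (pivP p' ⊗ A))
    (y : Hom (Y ⊗ pivP p') (pivP p' ⊗ Y)) :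
    @universal (reverse C) A Y H e ->
    is_iso x -> is_iso s -> is_iso a -> is_iso a' -> is_iso y ->
    crosses (idm (pivP p')) e (tensor_braid a' s) y ->
    crosses f (idm A) a a' ->
    crosses f (e ∘ (idm A ⊠ u)) (tensor_braid a x) y ->
  crosses f u x s.
Proof.
move=> ue [x1 xx] [s1 ss] [a1 aa] [a'1 aa'] [y1 yy] es fa feu.
have ia1 : @is_iso (reverse C) _ _ a1 by exists a; case: aa.
apply/(crosses_reverse _ _ xx ss).
apply: (@crosses_of_eval (reverse C) (reverse_pair p) (reverse_pair p')
          f A Y H X e u x1 s1 a1 a'1 y1) => //.
- exact/(crosses_reverse _ _ (tensor_braid_reverse aa' ss) yy).
- exact/(crosses_reverse _ _ aa aa').
- exact/(crosses_reverse _ _ (tensor_braid_reverse aa xx) yy).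
Qed.

Lemma intertwining_iso (C : StrictMonoidal) (p : PivotalPair C) (X : C)
    (s : Hom (X ⊗ pivP p) (pivP p ⊗ X)) : intertwining s -> is_iso s.
Proof. by move=> [t [st _]]; exists t. Qed.

Lemma crosses_comp (C : StrictMonoidal) (P P' P'' X X' X'' : C)
    (f : Hom P P') (f' : Hom P' P'') (u : Hom X X') (u' : Hom X' X'')
    (s : Hom (X ⊗ P) (P ⊗ X)) (s' : Hom (X' ⊗ P') (P' ⊗ X'))
    (s'' : Hom (X'' ⊗ P'') (P'' ⊗ X'')) :
  crosses f u s s' -> crosses f' u' s' s'' -> crosses (f' ∘ f) (u' ∘ u) s s''.
Proof.
by rewrite /crosses !tenm_comp => us us'; rewrite compA us' -compA us compA.
Qed.

(** * Lifting the adjunctions *)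

Lemma counit_universal (C D : Category) (F : Functor C D) (R : RightAdjoint F)
    (X : C) (Y : D) (g : Hom (F X) Y) :
  exists! u : Hom X (radj R Y), adj_counit R Y ∘ fmap F u = g.
Proof.
exists (fmap (radj R) g ∘ adj_unit R X); split=> [|u <-].
  by rewrite fmap_comp compA adj_counit_nat -compA adj_triangleF comp_idr.
by rewrite fmap_comp -compA -adj_unit_nat compA adj_triangleG comp_idl.
Qed.

(** Comparing the values on morphisms as arrows includes comparing the values on
    objects. *)
Lemma Functor_eq (C D : Category) (F G : Functor C D) :
  (forall X Y (f : Hom X Y), fmap F f ≈ fmap G f) -> F = G.
Proof.
case: F G => [Fo Fm Fi Fc] [Go Gm Gi Gc] /= em.
have eo : Fo = Go.
  by apply: functional_extensionality => X; have /(congr1 (@dom D)) := em X X (idm X).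
case: _ / eo Gm Gi Gc em => Gm Gi Gc em.
have e : Fm = Gm.
  do 3!(apply: functional_extensionality_dep => ?).
  by apply: Arrow_inj.
case: _ / e Gi Gc {em} => Gi Gc.
by rewrite (proof_irrelevance _ Fi Gi) (proof_irrelevance _ Fc Gc).
Qed.

Lemma left_counit_universal (C : StrictMonoidal) (L : LeftClosed C) (A Y : C) :
  universal (adj_counit (L A) Y).
Proof. by move=> X g; exact: (@counit_universal _ _ _ (L A) X Y g). Qed.
Arguments left_counit_universal {C} L A Y.

Lemma right_counit_universal (C : StrictMonoidal) (L : RightClosed C) (A Y : C) :
  @universal (reverse C) A Y (L A Y) (adj_counit (L A) Y).
Proof. by move=> X g; exact: (@counit_universal _ _ _ (L A) X Y g). Qed.
Arguments right_counit_universal {C} L A Y.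

Section LeftLift.
Variables (J : Category) (C : StrictMonoidal) (D : PivotalDiagram J C).
Variables (L : LeftClosed C) (A : IntertwinedObject D).

(** A choice in form only: by universality the property chosen for determines the
    braiding. *)
Definition left_hom_braid (Y : IntertwinedObject D) (i : J) :=
  constructive_indefinite_description _
    (hom_braiding (left_counit_universal L A Y)
                  (io_intertwining A i) (io_intertwining Y i)).

Lemma left_hom_crosses (X : C) (Y : IntertwinedObject D) (i i' : J)
    (f : Hom i i') (u : Hom X (L A Y)) (x : Hom (X ⊗ pivP (D i)) (pivP (D i) ⊗ X)) :
    crosses (diag_mor D f) (adj_counit (L A) Y ∘ (u ⊠ idm (io_ob A)))
            (tensor_braid x (io_braid A i)) (io_braid Y i') ->
  crosses (diag_mor D f) u x (sval (left_hom_braid Y i')).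
Proof.
apply: (crosses_of_eval (left_counit_universal L A Y)).
- exact: intertwining_iso (io_intertwining A i).
- exact: proj2 (svalP (left_hom_braid Y i')).
- exact: esym (io_natural A f).
Qed.

Program Definition left_hom (Y : IntertwinedObject D) : IntertwinedObject D :=
  {| io_ob := L A Y; io_braid i := sval (left_hom_braid Y i) |}.
Next Obligation. exact: proj1 (svalP (left_hom_braid Y i)). Qed.
Next Obligation.
(* the evaluation followed by naturality of the braiding of [Y] *)
apply/esym/left_hom_crosses; rewrite tenm_id comp_idr.
have := crosses_comp (proj2 (svalP (left_hom_braid Y i))) (esym (io_natural Y f)).
by rewrite comp_idl comp_idr.
Qed.

(** A morphism into the inner hom lifts as soon as its transpose does; this gives
    the functorial action (transpose [f ∘ eval]) and the unit (transpose [id]). *)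
Lemma left_hom_lift (X Y : IntertwinedObject D) (u : Hom (io_ob X) (L A Y))
    (g : IntertwinedHom (io_ten X A) Y) :
    adj_counit (L A) Y ∘ (u ⊠ idm (io_ob A)) = g -> forall i,
  crosses (idm (pivP (D i))) u (io_braid X i) (io_braid (left_hom Y) i).
Proof.
move=> ug i; have := @left_hom_crosses X Y i i (idm i) u (io_braid X i).
rewrite /diag_mor fmap_id; apply; rewrite ug; exact: ih_comm g i.
Qed.

Definition left_eval (Y : IntertwinedObject D) : IntertwinedHom (io_ten (left_hom Y) A) Y :=
  @Build_IntertwinedHom _ _ _ (io_ten (left_hom Y) A) Y (adj_counit (L A) Y)
    (fun i => proj2 (svalP (left_hom_braid Y i))).

Program Definition left_hom_functor : Functor (IntertwinedMonoidal D) (IntertwinedMonoidal D) :=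
  {| fob := left_hom : IntertwinedMonoidal D -> IntertwinedMonoidal D;
     fmap X Y f := @Build_IntertwinedHom _ _ _ (left_hom X) (left_hom Y)
       (fmap (radj (L A)) (ih_mor f)) _ |}.
Next Obligation.
apply: (@left_hom_lift (left_hom X) Y _ (ih_comp f (left_eval X))).
exact: (adj_counit_nat (L A)).
Qed.
Next Obligation. by apply: IntertwinedHom_eq; apply: (fmap_id (radj (L A))). Qed.
Next Obligation. by apply: IntertwinedHom_eq; apply: (fmap_comp (radj (L A))). Qed.

Program Definition left_adjoint : RightAdjoint (@tensor_right (IntertwinedMonoidal D) A) :=
  {| radj := left_hom_functor;
     adj_unit X := @Build_IntertwinedHom _ _ _ X (left_hom (io_ten X A))
                     (adj_unit (L A) (io_ob X)) _;
     adj_counit Y := left_eval Y |}.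
Next Obligation.
apply: (@left_hom_lift X (io_ten X A) _ (ih_id _)).
exact: (adj_triangleF (L A)).
Qed.
Next Obligation. by apply: IntertwinedHom_eq; apply: (adj_unit_nat (L A)). Qed.
Next Obligation. by apply: IntertwinedHom_eq; apply: (adj_counit_nat (L A)). Qed.
Next Obligation. by apply: IntertwinedHom_eq; apply: (adj_triangleF (L A)). Qed.
Next Obligation. by apply: IntertwinedHom_eq; apply: (adj_triangleG (L A)). Qed.
End LeftLift.

Definition left_closed_lift (J : Category) (C : StrictMonoidal)
    (D : PivotalDiagram J C) (L : LeftClosed C) : LeftClosed (IntertwinedMonoidal D) :=
  fun A => left_adjoint L A.

Section RightLift.
Variables (J : Category) (C : StrictMonoidal) (D : PivotalDiagram J C).
Variables (L : RightClosed C) (A : IntertwinedObject D).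

Definition right_hom_braid (Y : IntertwinedObject D) (i : J) :=
  constructive_indefinite_description _
    (hom_braiding_right (right_counit_universal L A Y)
                  (io_intertwining A i) (io_intertwining Y i)).

Lemma right_hom_crosses (X : C) (Y : IntertwinedObject D) (i i' : J)
    (f : Hom i i') (u : Hom X (L A Y)) (x : Hom (X ⊗ pivP (D i)) (pivP (D i) ⊗ X)) :
    is_iso x ->
    crosses (diag_mor D f) (adj_counit (L A) Y ∘ (idm (io_ob A) ⊠ u))
            (tensor_braid (io_braid A i) x) (io_braid Y i') ->
  crosses (diag_mor D f) u x (sval (right_hom_braid Y i')).
Proof.
move=> xiso.
apply: (crosses_of_eval_right (right_counit_universal L A Y)) => //.
- exact: intertwining_iso (proj1 (svalP (right_hom_braid Y i'))).
- exact: intertwining_iso (io_intertwining A i).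
- exact: intertwining_iso (io_intertwining A i').
- exact: intertwining_iso (io_intertwining Y i').
- exact: proj2 (svalP (right_hom_braid Y i')).
- exact: esym (io_natural A f).
Qed.

Program Definition right_hom (Y : IntertwinedObject D) : IntertwinedObject D :=
  {| io_ob := L A Y; io_braid i := sval (right_hom_braid Y i) |}.
Next Obligation. exact: proj1 (svalP (right_hom_braid Y i)). Qed.
Next Obligation.
apply/esym/right_hom_crosses.
  exact: intertwining_iso (proj1 (svalP (right_hom_braid Y i))).
rewrite tenm_id comp_idr.
have := crosses_comp (proj2 (svalP (right_hom_braid Y i))) (esym (io_natural Y f)).
by rewrite comp_idl comp_idr.
Qed.

Lemma right_hom_lift (X Y : IntertwinedObject D) (u : Hom (io_ob X) (L A Y))
    (g : IntertwinedHom (io_ten A X) Y) :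
    adj_counit (L A) Y ∘ (idm (io_ob A) ⊠ u) = g -> forall i,
  crosses (idm (pivP (D i))) u (io_braid X i) (io_braid (right_hom Y) i).
Proof.
move=> ug i; have := @right_hom_crosses X Y i i (idm i) u (io_braid X i).
rewrite /diag_mor fmap_id; apply; last by rewrite ug; exact: ih_comm g i.
exact: intertwining_iso (io_intertwining X i).
Qed.

Definition right_eval (Y : IntertwinedObject D) : IntertwinedHom (io_ten A (right_hom Y)) Y :=
  @Build_IntertwinedHom _ _ _ (io_ten A (right_hom Y)) Y (adj_counit (L A) Y)
    (fun i => proj2 (svalP (right_hom_braid Y i))).

Program Definition right_hom_functor : Functor (IntertwinedMonoidal D) (IntertwinedMonoidal D) :=
  {| fob := right_hom : IntertwinedMonoidal D -> IntertwinedMonoidal D;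
     fmap X Y f := @Build_IntertwinedHom _ _ _ (right_hom X) (right_hom Y)
       (fmap (radj (L A)) (ih_mor f)) _ |}.
Next Obligation.
apply: (@right_hom_lift (right_hom X) Y _ (ih_comp f (right_eval X))).
exact: (adj_counit_nat (L A)).
Qed.
Next Obligation. by apply: IntertwinedHom_eq; apply: (fmap_id (radj (L A))). Qed.
Next Obligation. by apply: IntertwinedHom_eq; apply: (fmap_comp (radj (L A))). Qed.

Program Definition right_adjoint : RightAdjoint (@tensor_left (IntertwinedMonoidal D) A) :=
  {| radj := right_hom_functor;
     adj_unit X := @Build_IntertwinedHom _ _ _ X (right_hom (io_ten A X))
                     (adj_unit (L A) (io_ob X)) _;
     adj_counit Y := right_eval Y |}.
Next Obligation.
apply: (@right_hom_lift X (io_ten A X) _ (ih_id _)).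
exact: (adj_triangleF (L A)).
Qed.
Next Obligation. by apply: IntertwinedHom_eq; apply: (adj_unit_nat (L A)). Qed.
Next Obligation. by apply: IntertwinedHom_eq; apply: (adj_counit_nat (L A)). Qed.
Next Obligation. by apply: IntertwinedHom_eq; apply: (adj_triangleF (L A)). Qed.
Next Obligation. by apply: IntertwinedHom_eq; apply: (adj_triangleG (L A)). Qed.
End RightLift.

Definition right_closed_lift (J : Category) (C : StrictMonoidal)
    (D : PivotalDiagram J C) (L : RightClosed C) : RightClosed (IntertwinedMonoidal D) :=
  fun A => right_adjoint L A.

Theorem theorem6p1 (J : Category) (C : StrictMonoidal) (D : PivotalDiagram J C) :
  (forall L : LeftClosed C,
     exists K : LeftClosed (IntertwinedMonoidal D),
       lifts_left_closed (forgetful D) K L /\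
       left_closed_functor (forgetful D) K L)
  /\
  (forall R : RightClosed C,
     exists K : RightClosed (IntertwinedMonoidal D),
       lifts_right_closed (forgetful D) K R /\
       right_closed_functor (forgetful D) K R).
Proof.
split=> [L|R].
  exists (left_closed_lift L); split=> [A|A Y]; first by split=> //; apply: Functor_eq.
  rewrite /left_comparison comp_along_erefl comp_idr (adj_triangleG (L A)).
  by exists (idm _); split; rewrite comp_idl.
exists (right_closed_lift R); split=> [A|A Y]; first by split=> //; apply: Functor_eq.
rewrite /right_comparison comp_along_erefl comp_idr (adj_triangleG (R A)).
by exists (idm _); split; rewrite comp_idl.
Qed.
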